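(* Let $n$ be a positive integer and $p$ a prime, and suppose there is a symmetric conference matrix $C\in\mathbb{C}^{n\times n}$ whose off-diagonal entries are all $p$th roots of unity. Then $p$ divides $n-2$, and there exists an $(n,m,c)$-DRACKN with $m=p$ and $c=(n-2)/p$.
   Context: A matrix $C\in\mathbb{C}^{n\times n}$ is called a symmetric conference matrix if (i) $C_{ii}=0$ for every $i$; (ii) $|C_{ij}|=1$ for all $i\neq j$; (iii) $C^\top=C$ (ordinary transpose); and (iv) $CC^*=(n-1)I_n$, where $C^*$ is the conjugate transpose. Given positive integers $n,m,c$, an $(n,m,c)$-DRACKN (distance-regular antipodal cover of the complete graph) is a simple graph on a set $V$ of $mn$ vertices together with a partition $\{V_i\}_{i=1}^n$ of $V$ into subsets of size $m$ (called fibers) such that: vertices in a common fiber are nonadjacent; for each pair of distinct fibers, the edges between them form a perfect matching between those two fibers; and any two nonadjacent vertices lying in distinct fibers have exactly $c$ common neighbors. Equivalently, ordering vertices fiber by fiber, its adjacency matrix $A$, viewed as an $n\times n$ block matrix with $m\times m$ blocks $A_{ij}$, satisfies $A_{ii}=0$, each $A_{ij}$ ($i\neq j$) is a permutation matrix, $A_{ij}^\top=A_{ji}$, and $A^2=(n-mc-2)A+(n-1)I_{mn}+c(J_n-I_n)\otimes J_m$, where $J_k$ is the $k\times k$ all-ones matrix.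
   Formalization: The statement is proved for n ≥ 2, since for n = 1 the matrix C = (0) satisfies the hypotheses but p does not divide n−2 = −1; and c = 0 is allowed in the definition of a DRACKN, as c = (n−2)/p is 0 when n = 2. *)

(* Defs.v *)
From HB Require Import structures.
From mathcomp Require Import all_boot all_order all_algebra.
From mathcomp Require Import complex.
From mathcomp Require Import reals.

Set Implicit Arguments.
Unset Strict Implicit.
Unset Printing Implicit Defensive.

Import Order.TTheory GRing.Theory Num.Theory.

Local Open Scope ring_scope.

Record symmetric_conference (R : realType) (n : nat) (C : 'M[R[i]]_n) : Prop :=
  SymmetricConference {
    symconf_diag : forall i, C i i = 0;
    symconf_norm : forall i j, i != j -> `|C i j| = 1;
    symconf_sym : C^T = C;
    symconf_gram : C *m map_mx Num.conj C^T = (n%:R - 1)%:M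
  }.

Local Close Scope ring_scope.

(* The parameter c may be 0, which is forced when n = 2 and c = (n - 2) / m. *)
(* Since [partition] excludes empty blocks, P is an unordered presentation   *)
(* of the family of n fibers.                                                *)
Record is_drackn (n m c : nat) (V : finType) (adj : rel V) (P : {set {set V}})
    : Prop := IsDrackn {
  drackn_n_gt0 : 0 < n;
  drackn_m_gt0 : 0 < m;
  drackn_sym : symmetric adj;
  drackn_irr : irreflexive adj;
  drackn_card : #|V| = m * n;
  drackn_partition : partition P [set: V];
  drackn_nfibers : #|P| = n;
  drackn_fiber_size : forall F, F \in P -> #|F| = m;
  drackn_fiber_indep :
    forall F x y, F \in P -> x \in F -> y \in F -> ~~ adj x y;
  (* Perfect matching: quantifying over ordered pairs of fibers also gives   *)
  (* each vertex of G exactly one neighbor in F.                             *)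
  drackn_matching :
    forall F G, F \in P -> G \in P -> F != G ->
    forall x, x \in F -> #|[set y in G | adj x y]| = 1;
  drackn_common :
    forall F G, F \in P -> G \in P -> F != G ->
    forall x y, x \in F -> y \in G -> ~~ adj x y ->
    #|[set z | adj x z && adj y z]| = c
}.

Definition drackn_exists (n m c : nat) : Prop :=
  exists (V : finType) (adj : rel V) (P : {set {set V}}),
    is_drackn n m c adj P.

(* Main.v *)
Require Import Defs.
From HB Require Import structures.
From mathcomp Require Import all_boot all_order all_algebra.
From mathcomp Require Import all_field.
From mathcomp Require Import complex.
From mathcomp Require Import reals.

(* Fix a primitive [p]th root of unity [z] and join [(i, a)] to [(j, b)] in    *)
(* ['I_n * 'I_p] when [i != j] and [z ^+ (a + b) = C i j]; using the sum, not  *)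
(* the difference, is what makes the graph undirected for a symmetric [C].     *)
(* The common neighbors of [(i, a)] and [(j, b)] correspond to the [k] outside *)
(* [{i, j}] with [C i k / C j k = z ^+ a / z ^+ b]. These [n - 2] quotients    *)
(* are [p]th roots of unity whose sum vanishes, by orthogonality of the rows;  *)
(* since the minimal polynomial of [z] over the rationals has degree [p - 1],  *)
(* every [p]th root of unity occurs equally often among them.                  *)

Set Implicit Arguments.
Unset Strict Implicit.
Unset Printing Implicit Defensive.

Import Order.TTheory GRing.Theory Num.Theory.

Local Open Scope ring_scope.

(** Arithmetic and combinatorics meet in one count: for [i != j], the number of [k] with
    [C i k / C j k = w]. [symmetric_conference_row_sum0] gives the vanishing sum, and
    [unity_roots_sum0_equidistributed] turns it into count times [p] equals [n - 2], whence both the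
    divisibility and the value of [c]. [drackn_of_unity_root_quotients] converts the count into the
    cover. *)

(** Since [z ^+ p - 1] is [z - 1] times the sum of the powers of [z], that sum vanishes at any [p]th
    root of unity other than 1; at 1 it equals [p], nonzero in characteristic 0. *)
Lemma prime_primitive_rootE (F : numFieldType) (p : nat) (z : F) :
  prime p -> p.-primitive_root z = root (\poly_(i < p) 1) z.
Proof.
move=> p_pr; have p_gt1 := prime_gt1 p_pr; have p_gt0 := prime_gt0 p_pr.
have sumE : (\poly_(i < p) 1).[z] = \sum_(i < p) z ^+ i.
  by rewrite horner_poly; apply: eq_bigr => i _; rewrite mul1r.
apply/idP/idP=> [zP | /rootP]; rewrite ?rootE sumE.
  have z1 : z - 1 != 0.
    apply: contraTneq p_gt1 => /eqP; rewrite subr_eq0 -[z]expr1.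
    by rewrite -(prim_order_dvd zP) dvdn1 => /eqP->.
  by rewrite -(mulrI_eq0 _ (lregP z1)) -subrX1 (prim_expr_order zP) subrr.
move=> s0; have zp1 : z ^+ p = 1 by apply/eqP; rewrite -subr_eq0 subrX1 s0 mulr0.
have [m zm m_dv_p] := prim_order_exists p_gt0 zp1.
have /primeP[_ /(_ m m_dv_p)/orP[] /eqP mE] := p_pr; last by rewrite -mE.
move: s0; rewrite mE in zm; rewrite -[z]expr1 (prim_expr_order zm).
under eq_bigr do rewrite expr1n.
by rewrite sumr_const card_ord => /eqP; rewrite pnatr_eq0 eqn0Ngt p_gt0.
Qed.

Lemma closed_prime_prim_root_exists (F : numClosedFieldType) (p : nat) :
  prime p -> exists z : F, p.-primitive_root z.
Proof.
move=> p_pr; have p_gt1 := prime_gt1 p_pr.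
have /closed_rootP[z zP] : size (\poly_(i < p) (1 : F)) != 1%N.
  by rewrite size_poly_eq ?oner_eq0 // neq_ltn p_gt1 orbT.
by exists z; rewrite prime_primitive_rootE.
Qed.

(* A nonzero [q] would share a nonconstant factor with [1 + X + .. + X^(p-1)], *)
(* hence a root in [algC], where cyclotomic minimal polynomials are known.     *)
Lemma small_rat_poly_prime_root (F : numFieldType) (p : nat) (z : F)
    (q : {poly rat}) :
  prime p -> p.-primitive_root z -> (size q < p)%N ->
  root (map_poly ratr q) z -> q = 0.
Proof.
move=> p_pr zP q_lt qz; apply/eqP/negPn/negP => q_neq0.
pose Phi (K : nzRingType) : {poly K} := \poly_(i < p) 1.
have PhiE (K : numFieldType) : Phi K = map_poly ratr (Phi rat).
  apply/polyP=> i; rewrite coef_map /= !coef_poly; case: ifP => _.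
    by rewrite rmorph1.
  by rewrite rmorph0.
have ncop : ~~ coprimep (Phi rat) q.
  apply/negP; rewrite -(coprimep_map (@ratr F)) -PhiE => /coprimep_root.
  by move/(_ z); rewrite -prime_primitive_rootE // (rootP qz) eqxx => /(_ zP).
have /closed_rootP[w] : size (map_poly (@ratr algC) (gcdp (Phi rat) q)) != 1%N.
  by rewrite size_map_poly.
rewrite gcdp_map root_gcd -PhiE -prime_primitive_rootE // => /andP[wP qw].
(* The minimal polynomial of [w] has size [totient p + 1 = p], too large to divide a nonzero [q]. *)
have [m [mE _] mP] := minCpolyP w; move: qw; rewrite mP => /dvdp_leq.
move/(_ q_neq0); rewrite -(size_map_poly (@ratr algC)) -mE.
rewrite (minCpoly_cyclotomic wP) size_cyclotomic totient_prime //.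
by rewrite prednK ?prime_gt0 // leqNgt q_lt.
Qed.

(** Subtracting [N p.-1] times the relation [1 + z + ... + z ^+ p.-1 = 0] kills the top coefficient;
    the rational polynomial that remains has size below [p] and root [z], so it is zero. *)
Lemma prim_root_sum0_const (F : numFieldType) (p : nat) (z : F)
    (N : nat -> nat) :
  prime p -> p.-primitive_root z -> \sum_(r < p) (N r)%:R * z ^+ r = 0 ->
  forall r, (r < p)%N -> N r = N p.-1.
Proof.
move=> p_pr zP sN0 r r_lt; have p_gt0 := prime_gt0 p_pr.
pose q : {poly rat} := \poly_(i < p.-1) ((N i)%:R - (N p.-1)%:R).
have q0 : q = 0.
  apply: (small_rat_poly_prime_root p_pr zP).
    by rewrite -[X in (_ < X)%N](prednK p_gt0) ltnS size_poly.
  rewrite rootE (horner_coef_wide (n := p.-1)); last first.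
    by rewrite size_map_poly size_poly.
  have : \sum_(i < p) ((N i)%:R - (N p.-1)%:R) * z ^+ i = 0.
    under eq_bigr do rewrite mulrBl.
    rewrite sumrB sN0 -mulr_sumr sub0r; apply/eqP; rewrite oppr_eq0.
    have := zP; rewrite prime_primitive_rootE // => /rootP.
    rewrite horner_poly; under eq_bigr do rewrite mul1r.
    by move=> ->; rewrite mulr0.
  rewrite -(big_mkord xpredT (fun i => ((N i)%:R - (N p.-1)%:R) * z ^+ i)).
  rewrite -[X in index_iota _ X](prednK p_gt0) big_nat_recr //= subrr mul0r.
  rewrite addr0 big_mkord => s0.
  rewrite -[eqbRHS]s0; apply/eqP; apply: eq_bigr => i _.
  by rewrite coef_map coef_poly ltn_ord /= rmorphB !rmorph_nat.
have [->//|r_neq] := eqVneq r p.-1.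
have r_lt' : (r < p.-1)%N by rewrite ltn_neqAle r_neq -ltnS prednK.
have /eqP := congr1 (fun u : {poly rat} => u`_r) q0; rewrite coef0 coef_poly r_lt' subr_eq0 eqr_nat.
by move/eqP.
Qed.

(** Grouping the terms by value gives a relation between the powers of [z] whose coefficients are
    the multiplicities. These are therefore equal, and they add up to [#|D|]. *)
Lemma unity_roots_sum0_equidistributed (F : numFieldType) (p : nat) (z : F)
    (T : finType) (D : {set T}) (f : T -> F) :
  prime p -> p.-primitive_root z -> {in D, forall t, f t ^+ p = 1} ->
  \sum_(t in D) f t = 0 ->
  forall w, w ^+ p = 1 -> (#|[set t in D | f t == w]| * p)%N = #|D|.
Proof.
move=> p_pr zP f1 sf0 w w1.
pose N r := #|[set t in D | f t == z ^+ r]|.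
have NE r : N r = (\sum_(t in D) (f t == z ^+ r))%N.
  rewrite /N -sum1_card big_mkcond [RHS]big_mkcond /=.
  by apply: eq_bigr => t _; rewrite inE; case: (t \in D); case: (f t == _).
have fE t : t \in D -> exists k : 'I_p, forall r : 'I_p, (f t == z ^+ r) = (r == k).
  move/f1/(prim_rootP zP) => [k ->]; exists k => r.
  by rewrite (eq_prim_root_expr zP) eq_sym !modn_small.
have Nconst : forall r, (r < p)%N -> N r = N p.-1.
  apply: (prim_root_sum0_const p_pr zP).
  under eq_bigr do rewrite NE natr_sum mulr_suml.
  rewrite exchange_big /= -[RHS]sf0; apply: eq_bigr => t /fE[k kE].
  rewrite (bigD1 k) //= kE eqxx mul1r big1 ?addr0 => [|r /negPf r_neq].
    by apply/eqP; rewrite eq_sym kE.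
  by rewrite kE r_neq mul0r.
have [k ->] := prim_rootP zP w1; rewrite -/(N k) Nconst //.
have -> : #|D| = (\sum_(r < p) N r)%N.
  under eq_bigr do rewrite NE.
  rewrite exchange_big -sum1_card; apply: eq_bigr => t /fE[l lE].
  by rewrite (bigD1 l) //= lE eqxx big1 // => r /negPf r_neq; rewrite lE r_neq.
by under eq_bigr do rewrite Nconst //; rewrite sum_nat_const card_ord mulnC.
Qed.

Lemma drackn_of_unity_root_quotients (F : fieldType) (n p c : nat) (z : F)
    (C : 'M[F]_n) :
  (0 < n)%N -> (0 < p)%N -> p.-primitive_root z -> C^T = C ->
  (forall i j, i != j -> C i j ^+ p = 1) ->
  (forall i j w, i != j -> w ^+ p = 1 ->
    #|[set k in ~: [set i; j] | C i k / C j k == w]| = c) ->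
  drackn_exists n p c.
Proof.
move=> n_gt0 p_gt0 zP Csym C1 Cquot.
pose V : finType := ('I_n * 'I_p)%type.
pose adj (x y : V) := (x.1 != y.1) && (z ^+ (x.2 + y.2) == C x.1 y.1).
pose fiber (i : 'I_n) : {set V} := [set x | x.1 == i].
have CE i j : C i j = C j i by rewrite -[in LHS]Csym mxE.
have z_neq0 k : z ^+ k != 0 by rewrite expf_neq0 // (prim_root_eq0 zP) -lt0n.
have zI (a b : 'I_p) : (z ^+ a == z ^+ b) = (a == b).
  by rewrite (eq_prim_root_expr zP) !modn_small.
have z1 k : (z ^+ k) ^+ p = 1 by rewrite exprAC (prim_expr_order zP) expr1n.
have C_neq0 i j : i != j -> C i j != 0.
  by move=> /C1 Cp; apply: contra_eq_neq Cp => ->;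
     rewrite expr0n eqn0Ngt p_gt0 eq_sym oner_eq0.
(* [(j, b)] will be the neighbor of [(i, a)] in the fiber over [j]. *)
have solve (a : 'I_p) i j : i != j -> {b : 'I_p | C i j = z ^+ (a + b)}.
  move=> ij; have [|b bE] := @prim_rootP _ _ _ zP (C i j / z ^+ a).
    by rewrite expr_div_n C1 // z1 divr1.
  by exists b; rewrite exprD -bE mulrC divfK.
have fiberI : injective fiber.
  move=> i j /setP/(_ (i, Ordinal p_gt0)); rewrite !inE eqxx => /esym/eqP //.
pose P := [set fiber i | i in 'I_n].
exists V, adj, P; split=> //.
- by move=> x y; rewrite /adj eq_sym addnC CE.
- by move=> x; rewrite /adj eqxx.
- by rewrite card_prod !card_ord mulnC.
- apply/and3P; split.
  + rewrite eqEsubset subsetT; apply/subsetP=> x _.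
    by apply/bigcupP; exists (fiber x.1); rewrite ?imset_f ?inE.
  + apply/trivIsetP=> _ _ /imsetP[i _ ->] /imsetP[j _ ->] ij.
    rewrite -setI_eq0; apply/eqP/setP=> x; rewrite !inE.
    by apply: contraNF ij => /andP[/eqP <- /eqP <-].
  + apply/imsetP=> -[i _ /setP/(_ (i, Ordinal p_gt0))].
    by rewrite !inE eqxx.
- by rewrite card_imset // card_ord.
- move=> _ /imsetP[i _ ->].
  have -> : fiber i = setX [set i] [set: 'I_p].
    by apply/setP=> -[j a]; rewrite !inE andbT.
  by rewrite cardsX cards1 cardsT card_ord mul1n.
- by move=> _ x y /imsetP[i _ ->]; rewrite !inE /adj => /eqP-> /eqP->; rewrite eqxx.
- move=> _ _ /imsetP[i _ ->] /imsetP[j _ ->]; rewrite (inj_eq fiberI) => ij.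
  move=> [i0 a]; rewrite inE /= => /eqP->; have [b bE] := solve a _ _ ij.
  apply/eqP/cards1P; exists (j, b); apply/setP=> -[k d].
  rewrite !inE /adj /= xpair_eqE; have [->|//] := eqVneq k j.
  by rewrite ij /= bE !exprD (inj_eq (mulfI (z_neq0 a))) zI.
- move=> _ _ /imsetP[i _ ->] /imsetP[j _ ->]; rewrite (inj_eq fiberI) => ij.
  move=> [i0 a] [j0 b]; rewrite !inE /= => /eqP-> /eqP-> _.
  set S := [set _ | _].
  have <- := Cquot i j (z ^+ a / z ^+ b) ij; last by rewrite expr_div_n !z1 divr1.
  (* In a common neighbor [(k, d)], [d] is forced by [z ^+ (a + d) = C i k], so it suffices to count
     the indices [k]. *)
  have fstI : {in S &, injective fst}.
    move=> [k d] [k' d']; rewrite !inE /adj /= => /andP[/andP[_ /eqP dE] _].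
    move=> /andP[/andP[_ /eqP dE'] _] kE; subst k'; congr (_, _); apply/eqP.
    by rewrite -zI -(inj_eq (mulfI (z_neq0 a))) -!exprD dE dE'.
  rewrite -(card_in_imset fstI); congr #|pred_of_set _|; apply/setP=> k.
  rewrite !inE negb_or; apply/imsetP/idP => [[[k0 d]]|].
    rewrite !inE /adj /= => /andP[/andP[ik /eqP aE] /andP[jk /eqP bE]] ->.
    by rewrite /= eq_sym ik eq_sym jk -aE -bE !exprD -mulf_div divff // mulr1 /=.
  case/andP=> /andP[ki kj]; rewrite eq_sym in ki; rewrite eq_sym in kj.
  (* [d] is chosen for adjacency to [(i, a)]; the quotient condition then yields adjacency to
     [(j, b)]. *)
  have [d dE] := solve a _ _ ki; rewrite dE => quotE.
  exists (k, d); rewrite // inE /adj /= ki kj dE eqxx /=.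
  rewrite eqr_div ?C_neq0 // !exprD in quotE *.
  by rewrite -(inj_eq (mulfI (z_neq0 a))) mulrA [_ * z ^+ b]mulrC -mulrA mulrC.
Qed.

(** This is orthogonality of rows [i] and [j]: conjugation inverts entries of modulus 1, and the
    zero diagonal removes the terms [k = i] and [k = j]. *)
Lemma symmetric_conference_row_sum0 (R : realType) (n : nat) (C : 'M[R[i]]_n)
    (i j : 'I_n) :
  symmetric_conference C -> i != j ->
  \sum_(k in ~: [set i; j]) C i k / C j k = 0.
Proof.
move=> CP ij; have /matrixP/(_ i j) := symconf_gram CP.
rewrite !mxE (negPf ij) mulr0n => s0; rewrite -[RHS]s0 big_mkcond; apply: eq_bigr => k _.
rewrite !inE negb_or !mxE; have [->|ki] := eqVneq k i.
  by rewrite /= (symconf_diag CP) mul0r.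
have [->|kj] := eqVneq k j; first by rewrite /= (symconf_diag CP) conjC0 mulr0.
by rewrite /= invC_norm (symconf_norm CP) 1?eq_sym // expr1n invr1 mul1r.
Qed.

Local Close Scope ring_scope.

Theorem theorem10 (R : realType) (n p : nat) (n_gt1 : 1 < n)
    (p_prime : prime p) (C : 'M[R[i]]_n)
    (C_conf : symmetric_conference C)
    (C_unity : forall i j, i != j -> (p.-unity_root (C i j))%R) :
  p %| n - 2 /\ drackn_exists n p ((n - 2) %/ p).
Proof.
have p_gt0 := prime_gt0 p_prime.
have [z zP] := closed_prime_prim_root_exists R[i] p_prime.
have C1 i j : i != j -> (C i j ^+ p = 1)%R by move/C_unity/unity_rootP.
have count i j w : i != j -> (w ^+ p = 1)%R ->
    #|[set k in ~: [set i; j] | (C i k / C j k == w)%R]| * p = n - 2.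
  move=> ij w1.
  rewrite (unity_roots_sum0_equidistributed p_prime zP) //.
  - by rewrite cardsCs setCK cards2 ij card_ord.
  - move=> k; rewrite !inE negb_or => /andP[ki kj].
    by rewrite expr_div_n !C1 1?eq_sym // divr1.
  - exact: symmetric_conference_row_sum0.
split.
  (* As [n > 1], rows 0 and 1 exist, and their count at [w = 1] is the cofactor of [p]. *)
  rewrite -(count (Ordinal (ltnW n_gt1)) (Ordinal n_gt1) 1%R) ?dvdn_mull //.
  by rewrite expr1n.
apply: (drackn_of_unity_root_quotients (ltnW n_gt1) p_gt0 zP) C1 _ => [|i j w ij w1].
  exact: symconf_sym C_conf.
by rewrite -(count i j w ij w1) mulnK.
Qed.
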